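(* Let $E$ be an arbitrary graph and $K$ a field with involution. The following are equivalent: (1) $L_K(E)$ is directly finite; (2) $L_K(E)$ is finite; (3) $E$ is no-exit.
   Context: A (directed) graph $E=(E^0,E^1,\mathbf{s},\mathbf{r})$ has vertex set $E^0$, edge set $E^1$, source and range maps; no finiteness or countability is assumed. A path is a vertex or a sequence $e_1\cdots e_n$ of edges with $\mathbf{r}(e_i)=\mathbf{s}(e_{i+1})$. A cycle is a path $e_1\cdots e_n$ ($n\ge1$) with $\mathbf{s}(e_1)=\mathbf{r}(e_n)$ and $\mathbf{s}(e_i)\ne\mathbf{s}(e_j)$ for $i\ne j$; $E$ is no-exit if $\mathbf{s}^{-1}(v)$ has exactly one element for every vertex $v$ lying on a cycle. A vertex $v$ is regular if $\mathbf{s}^{-1}(v)$ is nonempty and finite. $K$ has an arbitrary involution. $L_K(E)$ is the free $K$-algebra generated by $E^0\cup E^1\cup\{e^*:e\in E^1\}$ subject to (V) $vw=\delta_{v,w}v$; (E1) $\mathbf{s}(e)e=e\mathbf{r}(e)=e$; (E2) $\mathbf{r}(e)e^*=e^*\mathbf{s}(e)=e^*$; (CK1) $e^*f=\delta_{e,f}\mathbf{r}(e)$; (CK2) $v=\sum_{e\in\mathbf{s}^{-1}(v)}ee^*$ for regular $v$; it has involution $(\sum a_ip_iq_i^* )^*=\sum a_i^*q_ip_i^*$ (with $p^*=e_n^*\cdots e_1^*$, $v^*=v$) and has local units. A ring with local units is directly finite if for all $x,y$ and every idempotent $u$ with $xu=ux=x$, $yu=uy=y$, $xy=u$ implies $yx=u$;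 a $*$-ring with local units is finite if for all $x$ and every idempotent $u$ with $xu=ux=x$, $xx^*=u$ implies $x^*x=u$. *)

(* Defs.v *)
From HB Require Import structures.
From mathcomp Require Import all_boot all_order all_algebra.
From Stdlib Require Import List.
Set Implicit Arguments.
Unset Strict Implicit.
Unset Printing Implicit Defensive.
Import GRing.Theory.
Local Open Scope ring_scope.

(* A graph E = (V, Ed, s, r): vertex type V, edge type Ed, source s, range r.
   No finiteness / countability / decidability assumptions. *)

Section LeavittPathAlgebra.
Variables (K : fieldType) (sigma : K -> K).
Variables (V Ed : Type) (s r : Ed -> V).

Fixpoint path_from (e : Ed) (l : list Ed) : Prop :=
  match l with
  | nil => True
  | f :: l' => r e = s f /\ path_from f l'
  end.

Definition is_cycle (c : list Ed) : Prop :=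
  exists e l, c = e :: l /\ path_from e l /\ s e = r (last l e)
              /\ NoDup (List.map s c).

Definition on_cycle (v : V) : Prop :=
  exists c, is_cycle c /\ exists e, In e c /\ s e = v.

Definition no_exit : Prop :=
  forall v, on_cycle v -> exists e, s e = v /\ forall f, s f = v -> f = e.

Inductive gen : Type :=
  | GV of V
  | GE of Ed
  | GG of Ed.      (* ghost edge e^* *)

Inductive term : Type :=
  | tgen of gen
  | tzero
  | tadd of term & term
  | tscale of K & term
  | tmul of term & term.

Definition tsum_ghost (l : list Ed) : term :=
  foldr (fun e acc => tadd (tmul (tgen (GE e)) (tgen (GG e))) acc) tzero l.

(* [lpa_eq x y] : x and y are equal in L_K(E), i.e. the smallest congruence
   on terms containing the axioms of an associative K-algebra (without unit)
   and the relations (V), (E1), (E2), (CK1), (CK2).  The quotient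
   term / lpa_eq is the free K-algebra modulo the ideal generated by the
   relations, i.e. L_K(E). *)
Inductive lpa_eq : term -> term -> Prop :=
  | eq_refl x : lpa_eq x x
  | eq_sym x y : lpa_eq x y -> lpa_eq y x
  | eq_trans x y z : lpa_eq x y -> lpa_eq y z -> lpa_eq x z
  | eq_add x x' y y' : lpa_eq x x' -> lpa_eq y y' -> lpa_eq (tadd x y) (tadd x' y')
  | eq_scale a x x' : lpa_eq x x' -> lpa_eq (tscale a x) (tscale a x')
  | eq_mul x x' y y' : lpa_eq x x' -> lpa_eq y y' -> lpa_eq (tmul x y) (tmul x' y')
  | ax_addA x y z : lpa_eq (tadd x (tadd y z)) (tadd (tadd x y) z)
  | ax_addC x y : lpa_eq (tadd x y) (tadd y x)
  | ax_add0 x : lpa_eq (tadd x tzero) x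
  | ax_addN x : lpa_eq (tadd x (tscale (-1) x)) tzero
  | ax_scale1 x : lpa_eq (tscale 1 x) x
  | ax_scaleA a b x : lpa_eq (tscale a (tscale b x)) (tscale (a * b) x)
  | ax_scaleDr a x y : lpa_eq (tscale a (tadd x y)) (tadd (tscale a x) (tscale a y))
  | ax_scaleDl a b x : lpa_eq (tscale (a + b) x) (tadd (tscale a x) (tscale b x))
  | ax_mulA x y z : lpa_eq (tmul x (tmul y z)) (tmul (tmul x y) z)
  | ax_mulDl x y z : lpa_eq (tmul (tadd x y) z) (tadd (tmul x z) (tmul y z))
  | ax_mulDr x y z : lpa_eq (tmul x (tadd y z)) (tadd (tmul x y) (tmul x z))
  | ax_scale_mull a x y : lpa_eq (tmul (tscale a x) y) (tscale a (tmul x y))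
  | ax_scale_mulr a x y : lpa_eq (tmul x (tscale a y)) (tscale a (tmul x y))
  | rel_V_eq v : lpa_eq (tmul (tgen (GV v)) (tgen (GV v))) (tgen (GV v))
  | rel_V_neq v w : v <> w -> lpa_eq (tmul (tgen (GV v)) (tgen (GV w))) tzero
  | rel_E1s e : lpa_eq (tmul (tgen (GV (s e))) (tgen (GE e))) (tgen (GE e))
  | rel_E1r e : lpa_eq (tmul (tgen (GE e)) (tgen (GV (r e)))) (tgen (GE e))
  | rel_E2r e : lpa_eq (tmul (tgen (GV (r e))) (tgen (GG e))) (tgen (GG e))
  | rel_E2s e : lpa_eq (tmul (tgen (GG e)) (tgen (GV (s e)))) (tgen (GG e))
  | rel_CK1_eq e : lpa_eq (tmul (tgen (GG e)) (tgen (GE e))) (tgen (GV (r e)))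
  | rel_CK1_neq e f : e <> f -> lpa_eq (tmul (tgen (GG e)) (tgen (GE f))) tzero
  (* (CK2): v regular, i.e. s^{-1}(v) is nonempty and finite, enumerated
     without repetition by the list l *)
  | rel_CK2 v (l : list Ed) :
      l <> nil -> NoDup l -> (forall e, In e l <-> s e = v) ->
      lpa_eq (tgen (GV v)) (tsum_ghost l).

(* the involution on L_K(E): (sum a_i p_i q_i^star)^star = sum a_i^* q_i p_i^*,
   i.e. v^star = v, e <-> e^star, (a x)^star = a^star x^star, (x y)^star = y^star x^star. *)
Fixpoint tstar (x : term) : term :=
  match x with
  | tgen (GV v) => tgen (GV v)
  | tgen (GE e) => tgen (GG e)
  | tgen (GG e) => tgen (GE e)
  | tzero => tzero
  | tadd x y => tadd (tstar x) (tstar y)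
  | tscale a x => tscale (sigma a) (tstar x)
  | tmul x y => tmul (tstar y) (tstar x)
  end.

(* directly finite (ring with local units) *)
Definition lpa_directly_finite : Prop :=
  forall x y u : term,
    lpa_eq (tmul u u) u ->
    lpa_eq (tmul x u) x -> lpa_eq (tmul u x) x ->
    lpa_eq (tmul y u) y -> lpa_eq (tmul u y) y ->
    lpa_eq (tmul x y) u -> lpa_eq (tmul y x) u.

(* finite (star-ring with local units) *)
Definition lpa_finite : Prop :=
  forall x u : term,
    lpa_eq (tmul u u) u ->
    lpa_eq (tmul x u) x -> lpa_eq (tmul u x) x ->
    lpa_eq (tmul x (tstar x)) u -> lpa_eq (tmul (tstar x) x) u.

End LeavittPathAlgebra.

(* Main.v *)
Require Import Defs.
From HB Require Import structures.
From mathcomp Require Import all_boot all_order all_algebra.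
From mathcomp Require Import boolp.
From Stdlib Require List.

(* Write [L = L_K(E)].  Directly finite implies finite because [u = x x^*] is
   self-adjoint, so that [y = x^*] is allowed in direct finiteness.  If a closed
   path [c] at [v] has an exit [f], then [x = c^*] contradicts
   finiteness: [c^* c = v], but [c c^* = v] would give [f^* = f^* c c^* = 0],
   hence [r(f) = 0], while vertices act nontrivially in a representation of [L].

   If [E] is no-exit and [x y = u], [d = u - y x <> 0], then the elements
   [y^i d x^j] are linearly independent (they behave as matrix units), so the
   subalgebra generated by [x], [y], [u] grows at least quadratically.  But
   finitely many vertices and edges generate an algebra of linear growth: words
   of length [n] are spanned by the [a b^*] with paths [a], [b] of length at
   most [n], one of which avoids all cycles; there are finitely many paths of
   the latter kind, and a path that enters a cycle is from then on determined by
   its length. *)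

Set Implicit Arguments.
Unset Strict Implicit.
Unset Printing Implicit Defensive.
Import GRing.Theory.
Local Open Scope ring_scope.

(** * The Leavitt path algebra as a quotient module *)

Section Algebra.
Local Open Scope quotient_scope.
Variables (K : fieldType) (V Ed : eqType) (s r : Ed -> V).

Local Notation tm := (term K V Ed).

(** [{classic tm}] supplies the choice structure that the quotient by [lpa_eq] needs, whatever the
    vertices and edges are. *)
Definition lpa_eqb (x y : {classic tm}) : bool := `[< lpa_eq s r x y >].

Lemma lpa_eqb_refl : reflexive lpa_eqb.
Proof. by move=> x; apply/asboolP; apply: Defs.eq_refl. Qed.

Lemma lpa_eqb_sym : symmetric lpa_eqb.
Proof. by move=> x y; apply/asboolP/asboolP; apply: Defs.eq_sym. Qed.

Lemma lpa_eqb_trans : transitive lpa_eqb.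
Proof.
by move=> y x z /asboolP xy /asboolP yz; apply/asboolP; apply: Defs.eq_trans yz.
Qed.

Canonical lpa_equiv := EquivRel lpa_eqb lpa_eqb_refl lpa_eqb_sym lpa_eqb_trans.

Definition lpa := {eq_quot lpa_equiv}.
HB.instance Definition _ := Choice.on lpa.

Definition cls (x : tm) : lpa := \pi_{eq_quot lpa_equiv} (x : {classic tm}).

Lemma clsP x y : cls x = cls y <-> lpa_eq s r x y.
Proof.
split=> [/eqmodP /asboolP //|xy].
by apply/eqmodP/asboolP.
Qed.

Definition rep (x : lpa) : tm := repr x.

Lemma repK x : cls (rep x) = x.
Proof. exact: reprK. Qed.

Lemma rep_cls x : lpa_eq s r (rep (cls x)) x.
Proof. by apply/clsP; rewrite repK. Qed.

Lemma lpa_ind (P : lpa -> Prop) : (forall x, P (cls x)) -> forall x, P x.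
Proof. by move=> Pc x; rewrite -[x]repK. Qed.

Definition lpa_add x y := cls (tadd (rep x) (rep y)).
Definition lpa_scale a x := cls (tscale a (rep x)).
(** Kept as a bare operation on the module: [L] has local units but in general no unit. *)
Definition lpa_mul x y := cls (tmul (rep x) (rep y)).

Lemma cls_lpa_add x y : cls (tadd x y) = lpa_add (cls x) (cls y).
Proof. by apply/clsP/eq_add; apply/Defs.eq_sym/rep_cls. Qed.

Lemma cls_lpa_scale a x : cls (tscale a x) = lpa_scale a (cls x).
Proof. by apply/clsP/eq_scale; apply/Defs.eq_sym/rep_cls. Qed.

Lemma cls_mul x y : cls (tmul x y) = lpa_mul (cls x) (cls y).
Proof. by apply/clsP/eq_mul; apply/Defs.eq_sym/rep_cls. Qed.

Lemma lpa_addA : associative lpa_add.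
Proof.
elim/lpa_ind=> x; elim/lpa_ind=> y; elim/lpa_ind=> z.
by rewrite -!cls_lpa_add; apply/clsP/ax_addA.
Qed.

Lemma lpa_addC : commutative lpa_add.
Proof.
elim/lpa_ind=> x; elim/lpa_ind=> y.
by rewrite -!cls_lpa_add; apply/clsP/ax_addC.
Qed.

Lemma lpa_add0 : left_id (cls (tzero _ _ _)) lpa_add.
Proof.
by elim/lpa_ind=> x; rewrite lpa_addC -cls_lpa_add; apply/clsP/ax_add0.
Qed.

Lemma lpa_addN : left_inverse (cls (tzero _ _ _)) (lpa_scale (-1)) lpa_add.
Proof.
elim/lpa_ind=> x; rewrite lpa_addC -cls_lpa_scale -cls_lpa_add.
exact/clsP/ax_addN.
Qed.

HB.instance Definition _ :=
  GRing.isZmodule.Build lpa lpa_addA lpa_addC lpa_add0 lpa_addN.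

Lemma cls_add x y : cls (tadd x y) = cls x + cls y.
Proof. exact: cls_lpa_add. Qed.

Lemma lpa_scaleA a b x : lpa_scale a (lpa_scale b x) = lpa_scale (a * b) x.
Proof.
by elim/lpa_ind: x => x; rewrite -!cls_lpa_scale; apply/clsP/ax_scaleA.
Qed.

Lemma lpa_scale1 : left_id 1 lpa_scale.
Proof. by elim/lpa_ind=> x; rewrite -cls_lpa_scale; apply/clsP/ax_scale1. Qed.

Lemma lpa_scaleDr : right_distributive lpa_scale (+%R).
Proof.
move=> a; elim/lpa_ind=> x; elim/lpa_ind=> y.
by rewrite -cls_add -!cls_lpa_scale -cls_add; apply/clsP/ax_scaleDr.
Qed.

Lemma lpa_scaleDl x : {morph lpa_scale^~ x : a b / a + b}.
Proof.
move=> a b; elim/lpa_ind: x => x; rewrite /= -!cls_lpa_scale.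
by rewrite -cls_add; apply/clsP/ax_scaleDl.
Qed.

HB.instance Definition _ := GRing.Zmodule_isLmodule.Build K lpa
  lpa_scaleA lpa_scale1 lpa_scaleDr lpa_scaleDl.

Lemma cls0 : cls (tzero _ _ _) = 0. Proof. by []. Qed.

Lemma cls_scale a x : cls (tscale a x) = a *: cls x.
Proof. exact: cls_lpa_scale. Qed.

Local Infix "**" := lpa_mul (at level 40, left associativity).

Lemma lmulA : associative lpa_mul.
Proof.
elim/lpa_ind=> x; elim/lpa_ind=> y; elim/lpa_ind=> z.
by rewrite -!cls_mul; apply/clsP/ax_mulA.
Qed.

Lemma lmulDl : left_distributive lpa_mul +%R.
Proof.
elim/lpa_ind=> x; elim/lpa_ind=> y; elim/lpa_ind=> z.
by rewrite -cls_add -!cls_mul -cls_add; apply/clsP/ax_mulDl.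
Qed.

Lemma lmulDr : right_distributive lpa_mul +%R.
Proof.
elim/lpa_ind=> x; elim/lpa_ind=> y; elim/lpa_ind=> z.
by rewrite -cls_add -!cls_mul -cls_add; apply/clsP/ax_mulDr.
Qed.

Lemma lscaleAl a x y : (a *: x) ** y = a *: (x ** y).
Proof.
elim/lpa_ind: x => x; elim/lpa_ind: y => y.
by rewrite -cls_scale -!cls_mul -cls_scale; apply/clsP/ax_scale_mull.
Qed.

Lemma lscaleAr a x y : x ** (a *: y) = a *: (x ** y).
Proof.
elim/lpa_ind: x => x; elim/lpa_ind: y => y.
by rewrite -cls_scale -!cls_mul -cls_scale; apply/clsP/ax_scale_mulr.
Qed.

Lemma lmul0l x : 0 ** x = 0.
Proof. by rewrite -(scale0r (0 : lpa)) lscaleAl !scale0r. Qed.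

Lemma lmul0r x : x ** 0 = 0.
Proof. by rewrite -(scale0r (0 : lpa)) lscaleAr !scale0r. Qed.

Lemma lmulBl x y z : (x - y) ** z = x ** z - y ** z.
Proof. by rewrite lmulDl -scaleN1r lscaleAl scaleN1r. Qed.

Lemma lmulBr x y z : x ** (y - z) = x ** y - x ** z.
Proof. by rewrite lmulDr -scaleN1r lscaleAr scaleN1r. Qed.

Lemma lmul_suml I (t : seq I) (F : I -> lpa) x :
  (\sum_(i <- t) F i) ** x = \sum_(i <- t) F i ** x.
Proof.
by apply: (big_morph (lpa_mul^~ x)) => [y z|]; rewrite (lmulDl, lmul0l).
Qed.

Lemma lmul_sumr I (t : seq I) (F : I -> lpa) x :
  x ** (\sum_(i <- t) F i) = \sum_(i <- t) x ** F i.
Proof. by apply: big_morph => [y z|]; rewrite (lmulDr, lmul0r). Qed.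

Definition vx v := cls (tgen K (GV Ed v)).
Definition ed e := cls (tgen K (GE V e)).
Definition gh e := cls (tgen K (GG V e)).

Lemma vxvx v : vx v ** vx v = vx v.
Proof. by rewrite -cls_mul; apply/clsP/rel_V_eq. Qed.

Lemma vxvx_neq v w : v != w -> vx v ** vx w = 0.
Proof. by move=> /eqP vw; rewrite -cls_mul; apply/clsP/rel_V_neq. Qed.

Lemma vxed e : vx (s e) ** ed e = ed e.
Proof. by rewrite -cls_mul; apply/clsP/rel_E1s. Qed.

Lemma edvx e : ed e ** vx (r e) = ed e.
Proof. by rewrite -cls_mul; apply/clsP/rel_E1r. Qed.

Lemma vxgh e : vx (r e) ** gh e = gh e.
Proof. by rewrite -cls_mul; apply/clsP/rel_E2r. Qed.

Lemma ghvx e : gh e ** vx (s e) = gh e.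
Proof. by rewrite -cls_mul; apply/clsP/rel_E2s. Qed.

Lemma ghed e : gh e ** ed e = vx (r e).
Proof. by rewrite -cls_mul; apply/clsP/rel_CK1_eq. Qed.

Lemma ghed_neq e f : e != f -> gh e ** ed f = 0.
Proof. by move=> /eqP ef; rewrite -cls_mul; apply/clsP/rel_CK1_neq. Qed.

(** This is (CK2) at a vertex emitting exactly one edge, where the sum has the single term
    [e e^*]. *)
Lemma edgh_unique e : (forall f, s f = s e -> f = e) -> ed e ** gh e = vx (s e).
Proof.
move=> e_uniq; rewrite -cls_mul -[LHS]addr0 -cls0 -cls_add.
apply/esym/clsP; apply: (@rel_CK2 _ _ _ s r _ [:: e]) => //.
  by apply: List.NoDup_cons => //; apply: List.NoDup_nil.
by move=> f; split=> [[<-|]//|/e_uniq->]; left.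
Qed.

End Algebra.

(** * Vertices are nonzero *)

Lemma InP (T : eqType) (x : T) l : List.In x l <-> x \in l.
Proof.
elim: l => //= y l IHl; rewrite inE; split.
  by case=> [->|/IHl ->]; rewrite ?eqxx ?orbT.
by case/orP => [/eqP->|/IHl]; [left|right].
Qed.

Lemma NoDupP (T : eqType) (l : seq T) : List.NoDup l <-> uniq l.
Proof.
elim: l => [|x l IHl] /=; first by split=> // _; apply: List.NoDup_nil.
rewrite List.NoDup_cons_iff InP IHl.
by split=> [[/negP -> ->]|/andP[/negP]].
Qed.

(* A branching system: every vertex carries a copy of [seq Ed * nat], and
   [branch e] embeds the copy at [r e] into the copy at [s e].  The images of
   the edges leaving [v] are disjoint; at a regular vertex they are the residue
   classes of the second component, hence cover the copy at [v], as (CK2)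
   demands. *)
Section Representation.
Variables (K : fieldType) (V Ed : eqType) (s r : Ed -> V).

Definition enumerates (v : V) (l : seq Ed) : Prop :=
  [/\ l <> [::], uniq l & forall e, (e \in l) = (s e == v)].

(** The empty list marks the vertices that are not regular, sinks and infinite emitters alike. *)
Definition out_edges (v : V) : seq Ed :=
  if pselect (exists l, enumerates v l) is left h then projT1 (cid h)
  else [::].

Lemma out_edgesP v : out_edges v <> [::] -> enumerates v (out_edges v).
Proof. by rewrite /out_edges; case: pselect => // h _; case: (cid h). Qed.

Lemma out_edges_regular v l : enumerates v l -> out_edges v <> [::].
Proof.
rewrite /out_edges => vl; case: pselect => [h|[]]; last by exists l.
by case: (cid h) => m [].
Qed.

Definition branch (e : Ed) (j : seq Ed * nat) : seq Ed * nat :=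
  if nilp (out_edges (s e)) then (e :: j.1, j.2)
  else (j.1, j.2 * size (out_edges (s e)) + index e (out_edges (s e)))%N.

Definition unbranch (v : V) (j : seq Ed * nat) :
    option (Ed * (seq Ed * nat)) :=
  match out_edges v, j.1 with
  | e0 :: l, q =>
      Some (nth e0 (e0 :: l) (j.2 %% (size l).+1), (q, j.2 %/ (size l).+1))
  | [::], e :: q => if s e == v then Some (e, (q, j.2)) else None
  | [::], [::] => None
  end%N.

Lemma unbranchK e j : unbranch (s e) (branch e j) = Some (e, j).
Proof.
rewrite /unbranch /branch; case: j => q n /=.
case: (out_edges (s e)) (@out_edgesP (s e)) => [|e0 l] /=; first by rewrite eqxx.
case=> // _ _ lE; have el : e \in e0 :: l by rewrite lE.
have ltel : (index e (e0 :: l) < (size l).+1)%N by rewrite -index_mem in el.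
rewrite modnMDl modn_small // (nth_index e0 el).
by rewrite divnMDl // divn_small // addn0.
Qed.

Lemma unbranchP v j e i :
  unbranch v j = Some (e, i) -> s e = v /\ branch e i = j.
Proof.
rewrite /unbranch; case: j => q n /=.
case outv: (out_edges v) (@out_edgesP v) => [|e0 l].
  by case: q => // f q _; case: eqP => // fv [<- <-] /=; rewrite /branch fv outv.
case=> // _ ul lE [<- <-].
set k := (n %% _)%N; have ltk : (k < (size l).+1)%N by rewrite ltn_mod.
have /eqP kv : s (nth e0 (e0 :: l) k) == v by rewrite -lE mem_nth.
by split=> //; rewrite /branch kv outv index_uniq //= -divn_eq.
Qed.

Lemma unbranch_regular v l j : enumerates v l -> unbranch v j <> None.
Proof.
by move=> /out_edges_regular; rewrite /unbranch; case: (out_edges v).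
Qed.

Local Notation module := (V -> seq Ed * nat -> K).

(** The action on functions on the branching system: a vertex restricts to its copy, [e] transports
    the copy at [r e] along [branch e], and [e^*] pulls back along [branch e]. *)
Fixpoint ev (x : term K V Ed) (phi : module) : module :=
  match x with
  | tgen (GV v) => fun w j => if w == v then phi w j else 0
  | tgen (GE e) => fun w j =>
      if unbranch w j is Some (f, i) then
        if f == e then phi (r e) i else 0 else 0
  | tgen (GG e) => fun w j => if w == r e then phi (s e) (branch e j) else 0
  | tzero => fun _ _ => 0
  | tadd x y => fun w j => ev x phi w j + ev y phi w j
  | tscale a x => fun w j => a * ev x phi w j
  | tmul x y => ev x (ev y phi)
  end.

(** Products act by composition, so the axioms with a sum or a scalar in the right factor rest on
    the linearity of each operator. *)
Lemma evD x phi psi :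
  ev x (fun w j => phi w j + psi w j) = fun w j => ev x phi w j + ev x psi w j.
Proof.
elim: x phi psi => [[v|e|e]||x IHx y IHy|a x IHx|x IHx y IHy] phi psi /=;
  apply/funext => w; apply/funext => j.
- by case: eqP => //; rewrite addr0.
- by case: (unbranch w j) => [[f i]|]; [case: eqP|]; rewrite ?addr0.
- by case: eqP => //; rewrite addr0.
- by rewrite addr0.
- by rewrite IHx IHy addrACA.
- by rewrite IHx mulrDr.
- by rewrite IHy IHx.
Qed.

Lemma evZ x a phi :
  ev x (fun w j => a * phi w j) = fun w j => a * ev x phi w j.
Proof.
elim: x phi => [[v|e|e]||x IHx y IHy|b x IHx|x IHx y IHy] phi /=;
  apply/funext => w; apply/funext => j.
- by case: eqP => //; rewrite mulr0.
- by case: (unbranch w j) => [[f i]|]; [case: eqP|]; rewrite ?mulr0.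
- by case: eqP => //; rewrite mulr0.
- by rewrite mulr0.
- by rewrite IHx IHy mulrDr.
- by rewrite IHx mulrCA.
- by rewrite IHy IHx.
Qed.

(** Each [e e^*] acts as the projection onto the image of [branch e], and these images are
    disjoint. *)
Lemma ev_tsum_ghost l phi w j : uniq l ->
  ev (tsum_ghost K V l) phi w j =
  if unbranch w j is Some (e, _) then if e \in l then phi w j else 0 else 0.
Proof.
elim: l => [|e l IHl] /=; first by case: (unbranch w j) => [[]|].
case/andP => el /IHl ->; case Eu: (unbranch w j) => [[f i]|]; last exact: addr0.
have [fw fi] := unbranchP Eu; rewrite inE.
case: eqP => [fe|_]; last by rewrite add0r.
by rewrite -fe in el *; rewrite (negbTE el) addr0 eqxx fw fi.
Qed.

Lemma ev_sound x y : lpa_eq s r x y -> ev x = ev y.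
Proof.
elim=> {x y} //=.
- by move=> x y z _ -> _ ->.
- by move=> x x' y y' _ -> _ ->.
- by move=> a x x' _ ->.
- by move=> x x' y y' _ -> _ ->.
- by move=> x y z; do 3!apply/funext => ?; rewrite addrA.
- by move=> x y; do 3!apply/funext => ?; rewrite addrC.
- by move=> x; do 3!apply/funext => ?; rewrite addr0.
- by move=> x; do 3!apply/funext => ?; rewrite mulN1r subrr.
- by move=> x; do 3!apply/funext => ?; rewrite mul1r.
- by move=> a b x; do 3!apply/funext => ?; rewrite mulrA.
- by move=> a x y; do 3!apply/funext => ?; rewrite mulrDr.
- by move=> a b x; do 3!apply/funext => ?; rewrite mulrDl.
- by move=> x y z; do 3!apply/funext => ?; rewrite evD.
- by move=> a x y; do 3!apply/funext => ?; rewrite evZ.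
- by move=> v; apply/funext => phi; apply/funext => w; apply/funext => j; case: eqP.
- move=> v w vw; apply/funext => phi; apply/funext => u; apply/funext => j.
  by case: eqP => // ->; case: eqP.
- move=> e; apply/funext => phi; apply/funext => w; apply/funext => j.
  case: eqP => // we; case Eu: (unbranch w j) => [[f i]|] //.
  by have [fw _] := unbranchP Eu; case: eqP => // fe; case: we; rewrite -fw fe.
- move=> e; apply/funext => phi; apply/funext => w; apply/funext => j.
  by case: (unbranch w j) => [[f i]|] //; rewrite eqxx.
- by move=> e; apply/funext => phi; apply/funext => w; apply/funext => j; case: eqP.
- move=> e; apply/funext => phi; apply/funext => w; apply/funext => j.
  by rewrite eqxx.
- move=> e; apply/funext => phi; apply/funext => w; apply/funext => j.
  by rewrite unbranchK eqxx; case: eqP => // ->.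
- move=> e f ef; apply/funext => phi; apply/funext => w; apply/funext => j.
  by rewrite unbranchK; case: (e =P f) => //; case: eqP.
(* (CK2): the images of the branches at a regular vertex cover its copy, so the sum of the
   projections is the projection of [v]. *)
- move=> v l l0 /NoDupP ul lE; apply/funext => phi; apply/funext => w.
  apply/funext => j; rewrite ev_tsum_ghost //.
  have vl : enumerates v l.
    split=> // e; apply/idP/eqP => [/InP/lE//|ev]; exact/InP/lE.
  case Eu: (unbranch w j) => [[f i]|].
    have [<- _] := unbranchP Eu.
    by have [_ _ ->] := vl.
  by case: eqP => // wv; case: (unbranch_regular (j := j) vl); rewrite -wv.
Qed.

Lemma vx_neq0 v : vx K s r v != 0.
Proof.
apply/eqP => /clsP /ev_sound /(congr1 (fun f => f (fun _ _ => 1) v ([::], 0%N))).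
by move=> /= /eqP; rewrite eqxx oner_eq0.
Qed.

End Representation.

(** * The involution *)

Section Star.
Variables (K : fieldType) (sigma : {rmorphism K -> K}).
Hypothesis sigmaK : involutive sigma.
Variables (V Ed : Type) (s r : Ed -> V).

Lemma tstarK : involutive (tstar sigma (V := V) (Ed := Ed)).
Proof.
elim=> [[]||x IHx y IHy|a x IHx|x IHx y IHy] //=.
- by rewrite IHx IHy.
- by rewrite sigmaK IHx.
- by rewrite IHx IHy.
Qed.

Lemma tstar_tsum_ghost (l : seq Ed) :
  tstar sigma (tsum_ghost K V l) = tsum_ghost K V l.
Proof. by elim: l => //= e l ->. Qed.

(** The involution permutes the axioms: it exchanges left and right rules and (E1) with (E2), and
    fixes (V), (CK1) and (CK2). *)
Lemma tstar_eq x y : lpa_eq s r x y ->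
  lpa_eq s r (tstar sigma x) (tstar sigma y).
Proof.
elim=> {x y} /=.
- by move=> x; apply: Defs.eq_refl.
- by move=> x y _; apply: Defs.eq_sym.
- by move=> x y z _ xy _; apply: Defs.eq_trans.
- by move=> x x' y y' _ xx _; apply: eq_add.
- by move=> a x x' _; apply: eq_scale.
- by move=> x x' y y' _ xx _ yy; apply: eq_mul.
- by move=> x y z; apply: ax_addA.
- by move=> x y; apply: ax_addC.
- by move=> x; apply: ax_add0.
- by move=> x; rewrite rmorphN1; apply: ax_addN.
- by move=> x; rewrite rmorph1; apply: ax_scale1.
- by move=> a b x; rewrite rmorphM; apply: ax_scaleA.
- by move=> a x y; apply: ax_scaleDr.
- by move=> a b x; rewrite rmorphD; apply: ax_scaleDl.
- by move=> x y z; apply/Defs.eq_sym/ax_mulA.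
- by move=> x y z; apply: ax_mulDr.
- by move=> x y z; apply: ax_mulDl.
- by move=> a x y; apply: ax_scale_mulr.
- by move=> a x y; apply: ax_scale_mull.
- by move=> v; apply: rel_V_eq.
- by move=> v w vw; apply: rel_V_neq => /esym.
- by move=> e; apply: rel_E2s.
- by move=> e; apply: rel_E2r.
- by move=> e; apply: rel_E1r.
- by move=> e; apply: rel_E1s.
- by move=> e; apply: rel_CK1_eq.
- by move=> e f ef; apply: rel_CK1_neq => /esym.
- by move=> v l l0 ul lE; rewrite tstar_tsum_ghost; apply: rel_CK2.
Qed.

Lemma directly_finite_finite :
  @lpa_directly_finite K V Ed s r -> lpa_finite sigma s r.
Proof.
move=> dfin x u uu xu ux xxu.
have us : lpa_eq s r (tstar sigma u) u.
  apply: Defs.eq_trans (xxu); apply: Defs.eq_trans (tstar_eq (Defs.eq_sym xxu)) _.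
  by rewrite /= tstarK; apply: Defs.eq_refl.
apply: (dfin x _ u) => //.
- apply: Defs.eq_trans (tstar_eq ux); apply: eq_mul; first exact: Defs.eq_refl.
  exact: Defs.eq_sym.
- apply: Defs.eq_trans (tstar_eq xu); apply: eq_mul; last exact: Defs.eq_refl.
  exact: Defs.eq_sym.
Qed.

End Star.

(** * Walks and cycles *)

Section Walks.
Variables (V Ed : eqType) (s r : Ed -> V).
Implicit Types (v w : V) (e f : Ed) (p q : seq Ed).

(** Explicit endpoints give the empty word a meaning and make concatenation and rotation easy. *)
Fixpoint walk v p w : bool :=
  if p is e :: p' then (s e == v) && walk (r e) p' w else v == w.

Lemma walk_cat v p q w :
  walk v (p ++ q) w <-> exists2 u, walk v p u & walk u q w.
Proof.
elim: p v => [|e p IHp] v /=.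
  by split=> [|[u /eqP->//]]; exists v.
split=> [/andP[-> /IHp]//|[u /andP[-> pu] qw] /=].
by apply/IHp; exists u.
Qed.

Lemma walk_rcons v p e w :
  walk v (rcons p e) w <-> walk v p (s e) /\ r e = w.
Proof.
rewrite -cats1 walk_cat /=; split=> [[u pu /andP[/eqP-> /eqP]]//|[pe ew]].
by exists (s e); rewrite // ew !eqxx.
Qed.

Lemma walk_path_from e p w :
  path_from s r e p /\ r (List.last p e) = w <-> walk (r e) p w.
Proof.
elim: p e => [|f p IHp] e; first by split=> [[_ /eqP]|/eqP].
have last_cons d : List.last (f :: p) d = List.last p f.
  elim: p f d {IHp} => [|g p IHp] f d //.
  by rewrite -[LHS]/(List.last (g :: p) d) !IHp.
rewrite last_cons.
rewrite /= eq_sym; split=> [[[-> pf] pw]|/andP[/eqP-> /IHp[]]//].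
by rewrite eqxx; apply/IHp.
Qed.

(** Rotate the cycle so that it starts with its edge leaving [v]. *)
Lemma on_cycle_closed_walk v :
  on_cycle s r v -> exists e p, walk v (e :: p) v.
Proof.
case=> _ [[e [p [-> [pe [ep _]]]]] [f [/InP ef fv]]].
have : walk (s e) (e :: p) (s e) by rewrite /= eqxx; apply/walk_path_from.
case/splitPr: ef => p1 p2 /walk_cat[u p1u p2e].
have uv : u = v by case/andP: p2e => /eqP <- _.
rewrite uv in p1u p2e.
by exists f, (p2 ++ p1); rewrite -cat_cons; apply/walk_cat; exists (s e).
Qed.

Lemma not_uniq_map_cat p : ~~ uniq (map s p) ->
  exists p1 e p2 f p3, p = p1 ++ (e :: p2) ++ f :: p3 /\ s e = s f.
Proof.
elim: p => //= e p IHp; rewrite negb_and negbK.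
case/orP => [/mapP[f /splitPr[p2 p3] ef]|/IHp[p1 [f [p2 [g [p3 [-> fg]]]]]]].
  by exists [::], e, p2, f, p3.
by exists (e :: p1), f, p2, g, p3.
Qed.

(** Strong induction on the length: if two edges share a source, cutting out the piece between them
    leaves a shorter nonempty closed walk at [v]. *)
Lemma closed_walk_on_cycle v e p : walk v (e :: p) v -> on_cycle s r v.
Proof.
have [n] := ubnP (size p); elim: n e p => // n IHn e p lpn vpv.
have [up|/not_uniq_map_cat] := boolP (uniq (map s (e :: p))).
  case/andP: vpv => /eqP ev /walk_path_from[pe pv].
  exists (e :: p); split; last by exists e; split=> //; left.
  exists e, p; split=> //; split=> //; split; first by rewrite pv.
  exact/NoDupP.
case=> p1 [f [p2 [g [p3 [Ep fg]]]]]; rewrite Ep in vpv.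
have {}vpv : walk v (p1 ++ g :: p3) v.
  have /walk_cat[u p1u /walk_cat[w uw wv]] := vpv.
  apply/walk_cat; exists u => //.
  have /andP[/eqP <- _] := uw; rewrite fg.
  by have /andP[/eqP gw _] := wv; rewrite gw.
have szp : (size (p1 ++ g :: p3) < size (e :: p))%N.
  by rewrite Ep !size_cat ltn_add2l -[ltnLHS]add0n ltn_add2r.
case Eq: (p1 ++ g :: p3) => [|h q]; first by case: (p1) Eq.
by rewrite Eq in vpv szp; apply: IHn vpv; exact: leq_trans szp lpn.
Qed.

Definition cyc v := `[< on_cycle s r v >].

Lemma cycP v : cyc v <-> exists e p, walk v (e :: p) v.
Proof.
split=> [/asboolP /on_cycle_closed_walk //|[e [p vpv]]].
exact/asboolP/(closed_walk_on_cycle vpv).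
Qed.

(** Only sources count: the last edge may still end on a cycle. *)
Definition acyc p := all (fun e => ~~ cyc (s e)) p.

(** A repeated source would put a closed walk through it. Hence acyclic walks over finitely many
    edges have bounded length. *)
Lemma acyc_uniq v p w : walk v p w -> acyc p -> uniq p.
Proof.
move=> vpw ap; apply: (@map_uniq _ _ s); apply/idPn => /not_uniq_map_cat.
case=> p1 [e [p2 [f [p3 [Ep ef]]]]]; move: vpw ap; rewrite {}Ep.
case/walk_cat=> u _ /walk_cat[x /andP[/eqP eu ux] /andP[/eqP fx _]].
rewrite /acyc !all_cat /= => /and3P[_ /andP[/negP[]]].
by apply/cycP; exists e, p2; rewrite /= eqxx ef fx.
Qed.

Lemma acyc_split p : exists p1 p2,
  [/\ p = p1 ++ p2, acyc p1 & if p2 is e :: _ then cyc (s e) else true].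
Proof.
elim: p => [|e p [p1 [p2 [-> ap1 cp2]]]]; first by exists [::], [::].
have [ce|ce] := boolP (cyc (s e)); first by exists [::], (e :: p1 ++ p2).
by exists (e :: p1), p2; split=> //=; rewrite ce.
Qed.

(** * Walks in no-exit graphs *)

Section NoExit.
Hypothesis noexit : no_exit s r.

Lemma cyc_inj e f : cyc (s e) -> s e = s f -> e = f.
Proof.
move=> /asboolP /noexit[g [_ gP]] ef.
by rewrite (gP e) // (gP f).
Qed.

(** A closed walk at [s e] has to begin with [e]; rotating it by one edge gives a closed walk at
    [r e]. *)
Lemma cyc_next e : cyc (s e) -> cyc (r e).
Proof.
move=> ce; have /cycP[f [p /andP[/eqP fe fp]]] := ce.
rewrite -(cyc_inj ce (esym fe)) in fp; apply/cycP.
case: p fp => [/eqP re|g p gp]; first by exists e, [::]; rewrite /= re !eqxx.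
exists g, (rcons p e); rewrite -rcons_cons; exact/walk_rcons.
Qed.

(** On a cycle there is only one way to continue, so the length determines the walk. *)
Lemma cyc_walk_size v p q w w' : cyc v -> walk v p w -> walk v q w' ->
  size p = size q -> p = q.
Proof.
elim: p q v => [|e p IHp] [|f q] v //= cv /andP[/eqP ev ep] /andP[/eqP fv fq] [].
rewrite -ev in cv fv; rewrite -(cyc_inj cv (esym fv)) in fq *.
by move=> /(IHp _ _ (cyc_next cv) ep fq) ->.
Qed.

Lemma walk_flatten_nseq v p n : walk v p v -> walk v (flatten (nseq n p)) v.
Proof.
move=> vpv; elim: n => [|n IHn] /=; first exact: eqxx.
by apply/walk_cat; exists v.
Qed.

Lemma flatten_nseqSr p n :
  flatten (nseq n.+1 p) = flatten (nseq n p) ++ p.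
Proof.
elim: n => [|n IHn]; first by rewrite /= cats0.
by rewrite -[LHS]/(p ++ flatten (nseq n.+1 p)) {1}IHn catA.
Qed.

(* Two closed walks at [r e], ending in [e] and [f], have equal powers. *)
Lemma cyc_prev e f : cyc (s e) -> cyc (s f) -> r e = r f -> e = f.
Proof.
move=> ce cf ef.
have closed g : cyc (s g) -> exists p, walk (r g) (rcons p g) (r g).
  move=> cg; have /cycP[h [p /andP[/eqP hg hp]]] := cg.
  rewrite -(cyc_inj cg (esym hg)) in hp.
  by exists p; apply/walk_rcons.
have [p pe] := closed e ce; have [q qf] := closed f cf.
rewrite -ef in qf.
(* Each exponent is the length of the other closed walk, so that the two powers have equal
   length. *)
have P1 := walk_flatten_nseq (size q).+1 pe.
have P2 := walk_flatten_nseq (size p).+1 qf.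
have := cyc_walk_size (cyc_next ce) P1 P2.
rewrite !size_flatten /shape !map_nseq !sumn_nseq !size_rcons mulnC.
move=> /(_ erefl); rewrite !flatten_nseqSr -!rcons_cat.
by move=> /rcons_inj[].
Qed.

Lemma acyc_cyc v p w : walk v p w -> cyc v -> acyc p -> p = [::].
Proof. by case: p => //= e p /andP[/eqP <- _] ->. Qed.

(** A walk that reaches a cycle never leaves the cycles again, so the last source decides for
    all. *)
Lemma acyc_last v p e w : walk v (rcons p e) w -> ~~ cyc (s e) ->
  acyc (rcons p e).
Proof.
elim: p v => [|f p IHp] v /=; first by rewrite andbT.
case/andP=> _ fp ce; rewrite -/(acyc (rcons p e)) (IHp _ fp ce) andbT.
apply: contra ce => /cyc_next; case/walk_rcons: fp => {IHp}.
elim: p (r f) => [|g p IHp] u /=; first by move=> /eqP ->.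
by move=> /andP[/eqP <- gp] ge /cyc_next; apply: IHp.
Qed.

End NoExit.
End Walks.

(** * Monomials *)

Section Monomials.
Variables (K : fieldType) (V Ed : eqType) (s r : Ed -> V).
Implicit Types (v w : V) (e f : Ed) (p q : seq Ed).

Local Notation L := (lpa K s r).
Local Notation cls := (@cls K V Ed s r).
Local Notation vx := (vx K s r).
Local Notation ed := (ed K s r).
Local Notation gh := (gh K s r).
Local Notation walk := (walk s r).
Local Infix "**" := (@lpa_mul K V Ed s r) (at level 40, left associativity).

(** The vertex [v] is used only for the empty word, as the trivial path. These are terms rather than
    classes because [tstar] is defined on terms. *)
Fixpoint tpath v p : term K V Ed :=
  if p is e :: p' then tmul (tgen K (GE V e)) (tpath (r e) p')
  else tgen K (GV Ed v).

Fixpoint tghost v p : term K V Ed :=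
  if p is e :: p' then tmul (tghost (r e) p') (tgen K (GG V e))
  else tgen K (GV Ed v).

Lemma tstar_tghost sigma v p : tstar sigma (tghost v p) = tpath v p.
Proof. by elim: p v => //= e p IHp v; rewrite IHp. Qed.

Definition pth v p : L := cls (tpath v p).
Definition gth v p : L := cls (tghost v p).

Lemma pth_cons v e p : pth v (e :: p) = ed e ** pth (r e) p.
Proof. exact: cls_mul. Qed.

Lemma gth_cons v e p : gth v (e :: p) = gth (r e) p ** gh e.
Proof. exact: cls_mul. Qed.

Lemma vx_pth v p w : walk v p w -> vx v ** pth v p = pth v p.
Proof.
case: p => [|e p] /=; first by rewrite vxvx.
by case/andP=> /eqP <- _; rewrite pth_cons lmulA vxed.
Qed.

Lemma gth_vx v p w : walk v p w -> gth v p ** vx v = gth v p.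
Proof.
case: p => [|e p] /=; first by rewrite vxvx.
by case/andP=> /eqP <- _; rewrite gth_cons -lmulA ghvx.
Qed.

Lemma gth_rcons v p e : walk v p (s e) ->
  gth v (rcons p e) = gh e ** gth v p.
Proof.
elim: p v => [|f p IHp] v /=; first by move=> /eqP ->; rewrite gth_cons vxgh ghvx.
by case/andP=> _ /IHp fp; rewrite !gth_cons fp lmulA.
Qed.

Lemma vx_gth v p w : walk v p w -> vx w ** gth v p = gth v p.
Proof.
elim: p v => [|e p IHp] v /=; first by move=> /eqP ->; rewrite vxvx.
by case/andP=> _ /IHp ep; rewrite gth_cons lmulA ep.
Qed.

Lemma gth_pth v p w : walk v p w -> gth v p ** pth v p = vx w.
Proof.
elim: p v => [|e p IHp] v /=; first by move=> /eqP ->; rewrite vxvx.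
case/andP=> _ ep; rewrite gth_cons pth_cons -lmulA (lmulA (gh e)) ghed.
by rewrite (vx_pth ep) IHp.
Qed.

Lemma finite_no_exit (sigma : K -> K) :
  lpa_finite sigma s r -> no_exit s r.
Proof.
move=> fin v /on_cycle_closed_walk[e [p vpv]]; exists e.
have /andP[/eqP ev _] := vpv; split=> // f fv.
apply/eqP/contraT => fe.
have /clsP : lpa_eq s r (tmul (tpath v (e :: p)) (tghost v (e :: p)))
                        (tgen K (GV Ed v)).
  rewrite -(tstar_tghost sigma); apply: fin; rewrite ?tstar_tghost;
    apply/clsP; rewrite cls_mul.
  - exact: vxvx.
  - exact: gth_vx vpv.
  - exact: vx_gth vpv.
  - exact: gth_pth vpv.
rewrite cls_mul -/(gth _ _) -/(pth _ _).
(* Compress [c c^* = v] by [f^*] and [f]: the left side vanishes since [c] starts with [e], and the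
   right side becomes [r f]. *)
rewrite -/(vx v) => /(congr1 (fun z => gh f ** z ** ed f)).
rewrite pth_cons !lmulA ghed_neq // !lmul0l -fv ghvx ghed => /esym/eqP.
by rewrite (negbTE (vx_neq0 _ _ _ _)).
Qed.

End Monomials.

(** * Linear growth *)

Section Span.
Variables (K : fieldType) (L : lmodType K).

Inductive lspan (S : L -> Prop) : L -> Prop :=
  | lspan_base z of S z : lspan S z
  | lspan0 : lspan S 0
  | lspanD x y of lspan S x & lspan S y : lspan S (x + y)
  | lspanZ a x of lspan S x : lspan S (a *: x).

Lemma lspan_map (S S' : L -> Prop) (g : L -> L) :
    g 0 = 0 -> (forall x y, g (x + y) = g x + g y) ->
    (forall a x, g (a *: x) = a *: g x) ->
    (forall z, S z -> lspan S' (g z)) ->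
  forall z, lspan S z -> lspan S' (g z).
Proof.
move=> g0 gD gZ gS z; elim=> {z} [z /gS//||x y _ IHx _ IHy|a x _ IHx].
- by rewrite g0; apply: lspan0.
- by rewrite gD; apply: lspanD.
- by rewrite gZ; apply: lspanZ.
Qed.

Lemma lspan_sub (S S' : L -> Prop) : (forall z, S z -> S' z) ->
  forall z, lspan S z -> lspan S' z.
Proof. by move=> SS'; apply: (@lspan_map _ _ id) => // z /SS'; apply: lspan_base. Qed.

Lemma lspan_seq (B : seq L) z : lspan (fun z => z \in B) z ->
  exists c : 'I_(size B) -> K, z = \sum_i c i *: B`_i.
Proof.
elim=> {z} [z zB||x y _ [c ->] _ [c' ->]|a x _ [c ->]].
- have lt_z : (index z B < size B)%N by rewrite index_mem.
  exists (fun i => (i == Ordinal lt_z)%:R).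
  rewrite (bigD1 (Ordinal lt_z)) //= eqxx scale1r nth_index // big1 ?addr0 //.
  by move=> i /negbTE ->; rewrite scale0r.
- by exists (fun=> 0); rewrite big1 // => i _; rewrite scale0r.
- exists (fun i => c i + c' i); rewrite -big_split /=.
  by apply: eq_bigr => i _; rewrite scalerDl.
- exists (fun i => a * c i); rewrite scaler_sumr.
  by apply: eq_bigr => i _; rewrite scalerA.
Qed.

(** The coefficient matrix has more rows than columns, so some nonzero row vector annihilates it. *)
Lemma lspan_dependent (I : finType) (B : seq L) (X : I -> L) :
    (size B < #|I|)%N -> (forall i, lspan (fun z => z \in B) (X i)) ->
  exists c : I -> K, (exists i, c i != 0) /\ \sum_i c i *: X i = 0.
Proof.
move=> ltBI /(_ _)/lspan_seq/cid spanX.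
pose A := \matrix_(k < #|I|, j < size B) projT1 (spanX (enum_val k)) j.
have /rowV0Pn[k /sub_kermxP kA k0] : kermx A != 0.
  by rewrite kermx_eq0 /row_free neq_ltn (leq_ltn_trans (rank_leq_col A)).
exists (fun i => k 0 (enum_rank i)); split.
  have /rV0Pn[i ki] := k0; exists (enum_val i); by rewrite enum_valK.
rewrite (eq_bigr (fun i => \sum_j (k 0 (enum_rank i) * A (enum_rank i) j) *: B`_j)).
  rewrite exchange_big big1 //= => j _; rewrite -scaler_suml.
  rewrite (reindex (@enum_val I I)) /=; last first.
    by exists enum_rank => i _; rewrite (enum_valK, enum_rankK).
  under eq_bigr do rewrite enum_valK.
  by have /matrixP/(_ 0 j) := kA; rewrite !mxE => ->; rewrite scale0r.
move=> i _; rewrite {1}(projT2 (spanX i)) scaler_sumr.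
by apply: eq_bigr => j _; rewrite scalerA mxE enum_rankK.
Qed.

End Span.

(** * Spanning monomials over finitely many generators *)

Section Growth.
Variables (K : fieldType) (V Ed : eqType) (s r : Ed -> V).
Hypothesis noexit : no_exit s r.
Variables (W : seq V) (F : seq Ed).
Hypothesis sW : forall e, e \in F -> s e \in W.
Hypothesis rW : forall e, e \in F -> r e \in W.
Implicit Types (v w : V) (e f : Ed) (p q : seq Ed).

Local Notation L := (lpa K s r).
Local Notation cls := (@cls K V Ed s r).
Local Notation vx := (vx K s r).
Local Notation ed := (ed K s r).
Local Notation gh := (gh K s r).
Local Notation pth := (pth K s r).
Local Notation gth := (gth K s r).
Local Notation walk := (walk s r).
Local Notation cyc := (cyc s r).
Local Notation acyc := (acyc s r).
Local Infix "**" := (@lpa_mul K V Ed s r) (at level 40, left associativity).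

(* A common final edge of [a] and [b] on a cycle can be cancelled, since there
   [e e^* = s(e)]; this is why only pairs with an acyclic member are needed. *)
Definition mono (n : nat) (z : L) : Prop := exists v a w b y,
  [/\ z = pth v a ** gth w b, walk v a y, walk w b y,
      acyc a || acyc b &
      [&& v \in W, w \in W, all (mem F) a, all (mem F) b,
          (size a <= n)%N & (size b <= n)%N]].

Lemma mono_leq m n z : (m <= n)%N -> mono m z -> mono n z.
Proof.
move=> mn [v [a [w [b [y [-> va wb ab /and5P[vW wW aF bF /andP[am bm]]]]]]]].
exists v, a, w, b, y; split=> //.
by rewrite vW wW aF bF (leq_trans am mn) (leq_trans bm mn).
Qed.

Lemma mono_vx n v z : mono n z -> lspan (mono n.+1) (vx v ** z).
Proof.
move=> nz; have [v' [a [w [b [y [Ez va _ _ _]]]]]] := nz.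
have [vv'|vv'] := eqVneq v v'.
  by rewrite Ez lmulA vv' (vx_pth _ va) -Ez; apply/lspan_base/(mono_leq _ nz).
by rewrite Ez -(vx_pth _ va) !lmulA vxvx_neq // !lmul0l; apply: lspan0.
Qed.

(** Prepending [e] to [a] works unless both members become cyclic; then [a] is empty, [b] ends in
    [e], and the two copies of [e] cancel. *)
Lemma mono_ed n e z : e \in F -> mono n z -> lspan (mono n.+1) (ed e ** z).
Proof.
move=> eF [v [a [w [b [y [-> va wb ab /and5P[vW wW aF bF /andP[an bn]]]]]]]].
have [ev|ev] := eqVneq (r e) v; last first.
  rewrite -(vx_pth _ va) -(edvx _ s) !lmulA -(lmulA (ed e)) vxvx_neq //.
  by rewrite lmul0r !lmul0l; apply: lspan0.
rewrite -ev in va *.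
have [ae_b|] := boolP (acyc (e :: a) || acyc b).
  apply: lspan_base; exists (s e), (e :: a), w, b, y.
  split=> //; first by rewrite pth_cons lmulA.
    by rewrite /= eqxx.
  by rewrite sW // wW bF /= eF aF ltnS an leqW.
rewrite negb_or => /andP[ae bc].
rewrite (negbTE bc) orbF in ab.
have ce : cyc (s e) by move: ae; rewrite /= -/(acyc a) ab andbT negbK.
have a0 := acyc_cyc va (cyc_next noexit ce) ab; rewrite {}a0 /= in va *.
(* Since [b] is not acyclic, it is nonempty and its last edge starts on a cycle; that edge ends at
   [r e], as [e] does, so it is [e]. *)
case/lastP: b wb bc bF bn => [//|b f] wb bc bF bn.
have /walk_rcons[wf fy] := wb.
have cf : cyc (s f) by apply: contraR bc; apply: acyc_last wb.
have fe : f = e by apply: (cyc_prev noexit) => //; rewrite fy (eqP va).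
rewrite {}fe {f cf fy wb} in wf bc bF bn *.
apply: lspan_base; exists (s e), [::], w, b, (s e); split=> //.
- rewrite (gth_rcons _ wf) lmulA edvx lmulA edgh_unique // => f fe.
  by apply/esym/(cyc_inj noexit ce).
- by rewrite /= eqxx.
- move: bF; rewrite all_rcons => /andP[_ bF].
  by rewrite sW // wW bF /= leqW // ltnW // -(size_rcons b e).
Qed.

(** If [a] is empty, [e^*] joins the ghost part and [a] stays acyclic; otherwise (CK1) removes the
    first edge of [a] or gives zero. *)
Lemma mono_gh n e z : e \in F -> mono n z -> lspan (mono n.+1) (gh e ** z).
Proof.
move=> eF [v [a [w [b [y [-> va wb ab /and5P[vW wW aF bF /andP[an bn]]]]]]]].
have [ev|ev] := eqVneq (s e) v; last first.
  rewrite -(vx_pth _ va) -(ghvx _ _ r) !lmulA -(lmulA (gh e)) vxvx_neq //.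
  by rewrite lmul0r !lmul0l; apply: lspan0.
rewrite -ev in va *.
case: a va ab aF an => [|f a] /=.
  move=> /eqP ey _ _ _; rewrite -ey in wb.
  apply: lspan_base; exists (r e), [::], w, (rcons b e), (r e); split=> //.
  - by rewrite (gth_rcons _ wb) !lmulA ghvx vxgh.
  - by rewrite /= eqxx.
  - exact/walk_rcons.
  - by rewrite rW // wW all_rcons /= eF bF size_rcons.
case/andP=> _ fa ab /andP[_ aF] fan.
have [ef|ef] := eqVneq e f; last first.
  by rewrite pth_cons !lmulA ghed_neq // !lmul0l; apply: lspan0.
apply: lspan_base; exists (r e), a, w, b, y; rewrite -ef in fa *; split=> //.
- by rewrite pth_cons !lmulA ghed (vx_pth _ fa).
- by case/orP: ab => [/andP[_ aa]|->]; rewrite ?orbT //; apply/orP; left.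
- by rewrite rW // wW aF bF /= !leqW // ltnW.
Qed.

Fixpoint supported (x : term K V Ed) : bool :=
  match x with
  | tgen (GV v) => v \in W
  | tgen (GE e) | tgen (GG e) => e \in F
  | tzero => true
  | tadd x y | tmul x y => supported x && supported y
  | tscale _ x => supported x
  end.

Lemma lspan_mono_leq m n z : (m <= n)%N -> lspan (mono m) z -> lspan (mono n) z.
Proof. by move=> mn; apply: lspan_sub => ?; apply: mono_leq. Qed.

(** A generator raises the length bound by at most one. The increment [D] depends on [x] but not on
    [n], which makes the growth linear. *)
Lemma lspan_mono_mul x : supported x -> exists D, forall n z,
  lspan (mono n) z -> lspan (mono (n + D)) (cls x ** z).
Proof.
have lin (t : L) := @lspan_map _ _ _ _ (lpa_mul t) (lmul0r t) (lmulDr t)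
  (fun a z => lscaleAr a t z).
elim: x => [[v|e|e]||x IHx y IHy|a x IHx|x IHx y IHy] /=.
- move=> vW; exists 1%N => n; rewrite addn1; apply: lin => z; exact: mono_vx.
- move=> eF; exists 1%N => n; rewrite addn1; apply: lin => z; exact: mono_ed.
- move=> eF; exists 1%N => n; rewrite addn1; apply: lin => z; exact: mono_gh.
- by exists 0%N => n z _; rewrite cls0 lmul0l; apply: lspan0.
- case/andP=> /IHx[D xD] /IHy[D' yD']; exists (D + D')%N => n z nz.
  rewrite cls_add lmulDl; apply: lspanD.
    by apply: lspan_mono_leq (xD _ _ nz); rewrite leq_add2l leq_addr.
  by apply: lspan_mono_leq (yD' _ _ nz); rewrite leq_add2l leq_addl.
- move=> /IHx[D xD]; exists D => n z nz.
  by rewrite cls_scale lscaleAl; apply/lspanZ/xD.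
- case/andP=> /IHx[D xD] /IHy[D' yD']; exists (D' + D)%N => n z nz.
  by rewrite cls_mul -lmulA addnA; apply/xD/yD'.
Qed.

Lemma lspan_mono_cls x : supported x -> exists D, lspan (mono D) (cls x).
Proof.
elim: x => [[v|e|e]||x IHx y IHy|a x IHx|x IHx y IHy] /=.
- move=> vW; exists 0%N; apply: lspan_base; exists v, [::], v, [::], v.
  by split; rewrite ?vxvx //= ?eqxx ?vW.
- move=> eF; exists 1%N; apply: lspan_base; exists (s e), [:: e], (r e), [::], (r e).
  split; rewrite /= ?eqxx ?orbT ?sW ?rW ?eF //.
  by rewrite pth_cons -!lmulA vxvx edvx.
- move=> eF; exists 1%N; apply: lspan_base; exists (r e), [::], (s e), [:: e], (r e).
  split; rewrite /= ?eqxx ?orbT ?sW ?rW ?eF //.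
  by rewrite gth_cons !lmulA vxvx vxgh.
- by exists 0%N; apply: lspan0.
- case/andP=> /IHx[D xD] /IHy[D' yD']; exists (D + D')%N.
  rewrite cls_add; apply: lspanD.
    by apply: lspan_mono_leq xD; rewrite leq_addr.
  by apply: lspan_mono_leq yD'; rewrite leq_addl.
- by move=> /IHx[D xD]; exists D; rewrite cls_scale; apply: lspanZ.
- case/andP=> /lspan_mono_mul[D xD] /IHy[D' yD']; exists (D' + D)%N.
  by rewrite cls_mul; apply: xD.
Qed.

(** * Counting the monomials *)

Fixpoint words n : seq (seq Ed) :=
  if n is n'.+1 then [::] :: [seq e :: p | e <- F, p <- words n'] else [:: [::]].

Lemma mem_words n p : all (mem F) p -> (size p <= n)%N -> p \in words n.
Proof.
elim: n p => [|n IHn] [|e p] //= /andP[eF pF] pn.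
by rewrite inE /=; apply/allpairsP; exists (e, p); split; rewrite ?IHn.
Qed.

(** If [s e] lies on a cycle, this is the only edge leaving [r e]; the default [e] concerns sinks
    only. *)
Definition next_edge e : Ed :=
  if pselect (exists f, s f = r e) is left h then projT1 (cid h) else e.

Lemma cyc_walk_traject e p w : cyc (s e) -> walk (r e) p w ->
  e :: p = traject next_edge e (size p).+1.
Proof.
elim: p e => [|f p IHp] e ce //= /andP[/eqP fe fp].
have -> : next_edge e = f.
  rewrite /next_edge; case: pselect => [h|[]]; last by exists f.
  case: (cid h) => g /= ge; apply: (cyc_inj noexit); last by rewrite ge.
  by rewrite ge; apply: cyc_next.
by rewrite {1}(IHp f) // fe; apply: cyc_next.
Qed.

(** Length [size F] suffices because acyclic walks repeat no edge. Other words may occur too: only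
    an upper bound is wanted. *)
Definition acyc_words := words (size F).

(** An acyclic prefix, then possibly a piece fixed by its first edge and its length, at most [n]. *)
Definition walk_words n : seq (seq Ed) := acyc_words ++
  [seq p ++ q | p <- acyc_words,
                q <- [seq traject next_edge e k | e <- F, k <- iota 0 n.+1]].

Lemma mem_acyc_words v p w :
  walk v p w -> acyc p -> all (mem F) p -> p \in acyc_words.
Proof.
move=> vpw ap pF; apply: mem_words => //.
by apply: uniq_leq_size (allP pF); apply: acyc_uniq vpw ap.
Qed.

Lemma mem_walk_words n v p w :
  walk v p w -> all (mem F) p -> (size p <= n)%N -> p \in walk_words n.
Proof.
move=> + + pn; have [p1 [p2 [Ep ap1 cp2]]] := acyc_split s r p.
rewrite Ep all_cat => /walk_cat[u vu uw] /andP[p1F p2F].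
have p1A := mem_acyc_words vu ap1 p1F; rewrite mem_cat.
case: p2 cp2 uw p2F Ep => [|e p2] ce uw p2F Ep; first by rewrite cats0 p1A.
apply/orP; right; apply/allpairsP; exists (p1, e :: p2); split=> //.
case/andP: uw => _ uw; case/andP: p2F => eF _.
apply/allpairsP; exists (e, (size p2).+1); split=> //.
  by rewrite mem_iota /= add0n ltnS (leq_trans _ pn) // Ep size_cat /= leq_addl.
exact: cyc_walk_traject uw.
Qed.

Definition monos n : seq L :=
  [seq pth vw.1 ab.1 ** gth vw.2 ab.2
    | vw <- [seq (v, w) | v <- W, w <- W],
      ab <- [seq (a, b) | a <- acyc_words, b <- walk_words n] ++
            [seq (a, b) | a <- walk_words n, b <- acyc_words]].

Lemma mem_monos n z : mono n z -> z \in monos n.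
Proof.
move=> [v [a [w [b [y [-> va wb ab /and5P[vW wW aF bF /andP[an bn]]]]]]]].
apply/allpairsP; exists ((v, w), (a, b)); split=> //=.
  by apply/allpairsP; exists (v, w).
rewrite mem_cat; apply/orP; case/orP: ab => [aa|ab]; [left|right].
- apply/allpairsP; exists (a, b); split=> //=.
    exact: mem_acyc_words va aa aF.
  exact: mem_walk_words wb bF bn.
- apply/allpairsP; exists (a, b); split=> //=.
    exact: mem_walk_words va aF an.
  exact: mem_acyc_words wb ab bF.
Qed.

(** One member of each pair comes from a list independent of [n], the other from a list growing
    linearly in [n]. *)
Lemma size_monos : exists C, forall n, (size (monos n) <= C * n.+1)%N.
Proof.
pose A := size acyc_words.
exists ((size W * size W) * (A * (A + A * size F) + (A + A * size F) * A))%N => n.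
have Hw : (size (walk_words n) <= (A + A * size F) * n.+1)%N.
  rewrite size_cat !size_allpairs size_iota mulnDl mulnA leq_add2r.
  by rewrite leq_pmulr.
rewrite !size_allpairs size_cat !size_allpairs -/A -[leqRHS]mulnA leq_mul //.
by rewrite mulnDl leq_add //; [rewrite -mulnA|rewrite mulnAC]; rewrite leq_mul.
Qed.

End Growth.

(** * Matrix units *)

Section MatrixUnits.
Variables (K : fieldType) (V Ed : eqType) (s r : Ed -> V).
Local Notation L := (lpa K s r).
Local Infix "**" := (@lpa_mul K V Ed s r) (at level 40, left associativity).
Variables x y u : L.
Hypotheses (uu : u ** u = u) (xu : x ** u = x) (ux : u ** x = x).
Hypotheses (yu : y ** u = y) (uy : u ** y = y) (xy : x ** y = u).

(** The idempotent whose vanishing is the claim [y x = u]. *)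
Definition defect := u - y ** x.
Local Notation d := defect.

Lemma xd : x ** d = 0.
Proof. by rewrite lmulBr lmulA xy xu ux subrr. Qed.

Lemma dy : d ** y = 0.
Proof. by rewrite lmulBl -lmulA xy yu uy subrr. Qed.

Lemma ud : u ** d = d.
Proof. by rewrite lmulBr lmulA uy uu. Qed.

Lemma dd : d ** d = d.
Proof. by rewrite {1}/d lmulBl ud -lmulA xd lmul0r subr0. Qed.

(** Iterated multiplication makes sense of the zeroth power without a unit. *)
Definition xpow k := iter k (lpa_mul x).
Definition ypow k := iter k (lpa_mul y).

Lemma xpow0 k : xpow k 0 = 0.
Proof. by elim: k => //= k ->; rewrite lmul0r. Qed.

Lemma xpowSr k z : xpow k.+1 z = xpow k (x ** z).
Proof. exact: iterSr. Qed.

Lemma xpow_mul k z t : xpow k z ** t = xpow k (z ** t).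
Proof. by elim: k => //= k IHk; rewrite -lmulA IHk. Qed.

Lemma u_ypow k t : u ** ypow k (d ** t) = ypow k (d ** t).
Proof. by case: k => [|k] /=; rewrite lmulA ?ud ?uy. Qed.

(** Cancel by [x y = u]; a surplus [x] dies on [d] since [x d = 0], and a surplus [y] dies since
    [d y = 0]. *)
Lemma d_xpow_ypow k i t :
  d ** xpow k (ypow i (d ** t)) = if i == k then d ** t else 0.
Proof.
elim: k i => [|k IHk] [|i]; first by rewrite /= lmulA dd.
- by rewrite /= lmulA dy lmul0l.
- by rewrite xpowSr /= lmulA xd lmul0l xpow0 lmul0r.
- by rewrite xpowSr /= lmulA xy u_ypow eqSS.
Qed.

(** The matrix unit [y^i d x^j]; the final [u] stands for the empty power of [x]. *)
Definition munit i j := ypow i (d ** xpow j u).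

Lemma munit_coeff k l i j :
  d ** xpow k u ** munit i j ** ypow l d =
  if (i == k) && (j == l) then d else 0.
Proof.
rewrite -(lmulA d) xpow_mul u_ypow d_xpow_ypow.
case: (i == k) => /=; last by rewrite lmul0l.
have -> : ypow l d = ypow l (d ** d) by rewrite dd.
by rewrite -lmulA xpow_mul u_ypow d_xpow_ypow eq_sym dd.
Qed.

(** Multiplying the relation by [d x^k] on the left and [y^l d] on the right leaves only the
    coefficient at [(k, l)], times [d]. *)
Lemma munit_free m (c : 'I_m * 'I_m -> K) kl :
  \sum_ij c ij *: munit ij.1 ij.2 = 0 -> c kl != 0 -> d = 0.
Proof.
move=> /(congr1 (fun z => d ** xpow kl.1 u ** z ** ypow kl.2 d)).
rewrite lmul0r lmul0l lmul_sumr lmul_suml (bigD1 kl) //= big1 => [|ij ijkl].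
  rewrite lscaleAr lscaleAl munit_coeff !eqxx /= addr0 => /eqP.
  by rewrite scaler_eq0 => /orP[->//|/eqP].
rewrite lscaleAr lscaleAl munit_coeff.
have -> : (ij.1 == kl.1 :> nat) && (ij.2 == kl.2 :> nat) = (ij == kl).
  by case: (ij) (kl) => [i j] [k l]; rewrite xpair_eqE.
by rewrite (negbTE ijkl) scaler0.
Qed.

End MatrixUnits.

(** * No exit implies direct finiteness *)

Section Finiteness.
Variables (K : fieldType) (V Ed : eqType) (s r : Ed -> V).
Local Infix "**" := (@lpa_mul K V Ed s r) (at level 40, left associativity).

Fixpoint tverts (x : term K V Ed) : seq V :=
  match x with
  | tgen (GV v) => [:: v]
  | tadd x y | tmul x y => tverts x ++ tverts y
  | tscale _ x => tverts x
  | _ => [::]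
  end.

Fixpoint tedges (x : term K V Ed) : seq Ed :=
  match x with
  | tgen (GE e) | tgen (GG e) => [:: e]
  | tadd x y | tmul x y => tedges x ++ tedges y
  | tscale _ x => tedges x
  | _ => [::]
  end.

Lemma supported_subset W F x :
  {subset tverts x <= W} -> {subset tedges x <= F} -> supported W F x.
Proof.
elim: x => [[v|e|e]||x IHx y IHy|a x IHx|x IHx y IHy] //= sW sF.
- by apply: sW; rewrite inE.
- by apply: sF; rewrite inE.
- by apply: sF; rewrite inE.
- by apply/andP; split; [apply: IHx|apply: IHy] => z zx;
    [apply: sW|apply: sF|apply: sW|apply: sF]; rewrite mem_cat zx ?orbT.
- by apply/andP; split; [apply: IHx|apply: IHy] => z zx;
    [apply: sW|apply: sF|apply: sW|apply: sF]; rewrite mem_cat zx ?orbT.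
Qed.

Lemma ex_supported (x : term K V Ed) : exists (W : seq V) (F : seq Ed),
  [/\ forall e, e \in F -> s e \in W, forall e, e \in F -> r e \in W
    & supported W F x].
Proof.
exists (tverts x ++ map s (tedges x) ++ map r (tedges x)), (tedges x); split.
- by move=> e eF; rewrite !mem_cat map_f // orbT.
- by move=> e eF; rewrite !mem_cat map_f // !orbT.
- by apply: supported_subset => // v vx; rewrite mem_cat vx.
Qed.

Lemma no_exit_directly_finite : no_exit s r -> @lpa_directly_finite K V Ed s r.
Proof.
move=> noexit x y u.
rewrite -!(@clsP K V Ed s r) !cls_mul => uu xu ux yu uy xy.
(* The product merely bundles the three terms, so that one pair [W], [F] supports them all. *)
have [W [F [sW rW]]] := ex_supported (tmul u (tmul x y)).
move=> /= /and3P[suppu suppx suppy].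
have [Du uD] := lspan_mono_cls noexit sW rW suppu.
have [Dx xD] := lspan_mono_mul noexit sW rW suppx.
have [Dy yD] := lspan_mono_mul noexit sW rW suppy.
have [C szC] := size_monos K s r W F.
have [Dd dD] : exists D, forall n z, lspan (mono W F n) z ->
    lspan (mono W F (n + D)) (defect (cls s r x) (cls s r y) (cls s r u) ** z).
  have := @lspan_mono_mul K _ _ s r noexit W F sW rW
    (tadd u (tscale (-1) (tmul y x))).
  rewrite /= suppu suppx suppy cls_add cls_scale scaleN1r cls_mul.
  exact.
(* With [D = Du + Dd + Dx + Dy], the monomials needed number at most [C (D + 1) m], which is less
   than [m^2] because [m = C (D + 1) + 1]. *)
pose m := (C * (Du + Dd + Dx + Dy).+1).+1.
have E_mono i j : (i < m)%N -> (j < m)%N ->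
    lspan (mono W F (Du + Dd + m * (Dx + Dy)))
      (munit (cls s r x) (cls s r y) (cls s r u) i j).
  move=> im jm.
  (* Build [y^i d x^j u] from the right, adding the increment of each factor to the bound [Du] for
     [u]. *)
  have xj : lspan (mono W F (Du + j * Dx)) (xpow (cls s r x) j (cls s r u)).
    elim: j {jm} => [|j IHj]; first by rewrite addn0.
    by rewrite mulSn [(Dx + _)%N]addnC addnA; apply: xD.
  have yi : lspan (mono W F (Du + j * Dx + Dd + i * Dy))
      (munit (cls s r x) (cls s r y) (cls s r u) i j).
    elim: i {im} => [|i IHi]; first by rewrite addn0; apply: dD.
    by rewrite mulSn [(Dy + _)%N]addnC addnA; apply: yD.
  apply: lspan_mono_leq yi.
  rewrite mulnDr addnA [(Du + _ + Dd)%N]addnAC.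
  by rewrite leq_add ?leq_add ?leq_mul // ltnW.
have lt_mm : (size (monos K s r W F (Du + Dd + m * (Dx + Dy))) <
              #|{: 'I_m * 'I_m}|)%N.
  rewrite card_prod card_ord (leq_ltn_trans (szC _)) //.
  have m_gt0 : (0 < m)%N by [].
  apply: (@leq_ltn_trans (C * (Du + Dd + Dx + Dy).+1 * m)); last first.
    by rewrite {3}/m mulSn -[ltnLHS]add0n ltn_add2r.
  rewrite -mulnA leq_mul2l; apply/orP; right.
  rewrite -(addnA _ Dx) -!(addSn (Du + Dd)) mulnDl [(m * _)%N]mulnC.
  by rewrite leq_add // leq_pmulr.
(* There are more matrix units than spanning monomials, so a nontrivial relation holds and the
   defect is zero. *)
have [|c [[kl ckl] c0]] := lspan_dependent lt_mm
    (X := fun ij : 'I_m * 'I_m =>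
          munit (cls s r x) (cls s r y) (cls s r u) ij.1 ij.2).
  by move=> ij; apply: lspan_sub (E_mono _ _ _ _) => // z; apply: mem_monos.
have /eqP := munit_free uu xu ux yu uy xy c0 ckl.
by rewrite subr_eq0 => /eqP <-.
Qed.

End Finiteness.

(* K a field with involution sigma (a ring automorphism with sigma^2 = id,
   possibly the identity); E = (V, Ed, s, r) an arbitrary graph. *)
Theorem theorem4p12 (K : fieldType) (sigma : {rmorphism K -> K})
  (Hsigma : involutive sigma) (V Ed : Type) (s r : Ed -> V) :
  (@lpa_directly_finite K V Ed s r <-> lpa_finite sigma s r) /\
  (lpa_finite sigma s r <-> no_exit s r).
Proof.
have df_f := @directly_finite_finite K sigma Hsigma V Ed s r.
(* [{classic V}] and [{classic Ed}] equip arbitrary types with a Boolean equality. *)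
have f_ne := @finite_no_exit K {classic V} {classic Ed} s r sigma.
have ne_df := @no_exit_directly_finite K {classic V} {classic Ed} s r.
by split; split=> // ?; [apply/ne_df/f_ne|apply/df_f/ne_df].
Qed.
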